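(* $\mathbb{R}^{\mathbb{N}}/\ell_1<_B\mathbb{R}^{\mathbb{N}}/\mathrm{bv}_0$.
   Context: $\mathbb{N}=\{0,1,2,\dots\}$. $\mathrm{bv}=\{a\in\mathbb{R}^{\mathbb{N}}:\sum_n|a(n)-a(n+1)|<+\infty\}$ and $\mathrm{bv}_0=\mathrm{bv}\cap c_0$, where $c_0$ is the set of real null sequences; $\ell_1$ is the set of absolutely summable real sequences. For a linear subspace $L\subseteq\mathbb{R}^{\mathbb{N}}$, $\mathbb{R}^{\mathbb{N}}/L$ is the equivalence relation on $\mathbb{R}^{\mathbb{N}}$ in which $a,b$ are equivalent iff $a-b\in L$. For equivalence relations $E,F$ on Polish spaces $Z,W$, $E\le_B F$ means there is a Borel function $\theta:Z\to W$ with $(x,y)\in E\iff(\theta(x),\theta(y))\in F$ for all $x,y\in Z$; $E<_B F$ means $E\le_B F$ and not $F\le_B E$. *)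

(* Defs.v *)
From HB Require Import structures.
From mathcomp Require Import all_boot all_order all_algebra.
From mathcomp Require Import all_classical all_reals all_analysis.

Set Implicit Arguments.
Unset Strict Implicit.
Unset Printing Implicit Defensive.
Import Order.TTheory GRing.Theory Num.Theory.
Import numFieldNormedType.Exports.

Local Open Scope classical_set_scope.
Local Open Scope ring_scope.

(* [borel_type T] has the same points as [T]; its measurable sets are the
   Borel sets of the topology of [T], i.e. <<s open >>. *)
Definition borel_type (T : ptopologicalType) := g_sigma_algebraType (@open T).

Definition borel_fun (Z W : ptopologicalType) (f : Z -> W) : Prop :=
  measurable_fun [set: borel_type Z] (f : borel_type Z -> borel_type W).

Definition borel_reducible (Z W : ptopologicalType)
    (E : Z -> Z -> Prop) (F : W -> W -> Prop) : Prop :=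
  exists2 theta : Z -> W,
    borel_fun theta & forall x y : Z, E x y <-> F (theta x) (theta y).

Definition borel_strictly_reducible (Z W : ptopologicalType)
    (E : Z -> Z -> Prop) (F : W -> W -> Prop) : Prop :=
  borel_reducible E F /\ ~ borel_reducible F E.

Section SequenceSpaces.
Variable R : realType.

(* The bare type [nat -> R] carries no canonical topology; [RN] is R^N with the
   product topology. *)
Definition RN : Type := {ptws nat -> R}.

HB.instance Definition _ := Topological.on RN.
HB.instance Definition _ := isPointed.Build RN (fun=> 0).

Definition ell1 : set (nat -> R) :=
  [set a | (\sum_(0 <= n <oo) `|a n|%:E < +oo)%E].

Definition c0 : set (nat -> R) :=
  [set a : nat -> R | a n @[n --> \oo] --> (0 : R)].

Definition bv : set (nat -> R) :=
  [set a | (\sum_(0 <= n <oo) `|a n - a n.+1|%:E < +oo)%E].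

Definition bv0 : set (nat -> R) := bv `&` c0.

Definition coset_equiv (L : set (nat -> R)) (a b : RN) : Prop :=
  L (fun n => a n - b n).

End SequenceSpaces.

(* Main.v *)
Require Import Defs.
From mathcomp Require Import all_boot all_order all_algebra.
From mathcomp Require Import all_classical all_reals all_analysis.
From mathcomp Require Import measurable_realfun zify lra ring.

(** The reduction of R^N/l1 to R^N/bv0 interleaves a sequence with zeros: the
    variation of a(0), 0, a(1), 0, ... is finite exactly when a is absolutely
    summable, and the interleaved sequence is then automatically null.

    There is no reduction the other way because l1 is a countable union of the
    closed sets { |a|_1 <= k }, whereas in bv0 a limit of uniformly bounded
    elements may leave the space: c 1_[N, m) has variation at most 2|c| for all m,
    but tends to c 1_[N, oo), which is not null. Suppose theta is a Borel
    reduction of R^N/bv0 to R^N/l1. Baire category is applied to points s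
    coding a sequence x together with an element g of bv0; y denotes x + g.

    - Since x and y are bv0-equivalent, theta(y) - theta(x) is in l1, and a
      Baire category argument gives k and a cylinder of length N on which
      |theta(y) - theta(x)|_1 <= k generically ([borel_uniform_bound]).
      The coding is arranged so that, inside this cylinder, one coordinate
      still decides whether g receives the increment 2^-N 1_[N, m), for any m
      ([staircase_swap]).
    - Let h = 2^-N 1_[N, oo). As y + h and y are never bv0-equivalent,
      theta(y + h) - theta(y) is never in l1, so some finite sum with signs
      separates the two images by more than 2k; by category, one such sum
      works with one rational threshold generically on a smaller cylinder, of
      length m say ([borel_separation]).
    - This smaller cylinder does not see the coordinates from m on, so y + h
      may be replaced in it by y + 2^-N 1_[N, m), that is, by the y-value of
      another point of the first cylinder having the same x
      ([shifted_cut_jump]). Two bounds by k against a gap larger than 2k are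
      contradictory.

    The points form a power of a discrete set, which makes the category
    arguments combinatorial: everything is expressed with finite agreement of
    sequences. *)

Set Implicit Arguments.
Unset Strict Implicit.
Unset Printing Implicit Defensive.
Import Order.TTheory GRing.Theory Num.Theory.
Import numFieldNormedType.Exports.

Local Open Scope classical_set_scope.
Local Open Scope ring_scope.

(** * Baire category in a countable power of a discrete set *)

Section Category.
Variable A : Type.
Implicit Types (s t : nat -> A) (n : nat) (U D B C : set (nat -> A)).

Definition agree n s t := forall i, (i < n)%N -> s i = t i.

(** The topology is the product of discrete topologies on [A], with basic open
    sets the cylinders [agree n s]. *)
Definition cyl_open U := forall s, U s -> exists n, agree n s `<=` U.

Definition cyl_dense D := forall s n, exists2 t, agree n s t & D t.

Definition comeager C := exists D : nat -> set (nat -> A),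
  (forall j, cyl_open (D j) /\ cyl_dense (D j)) /\ \bigcap_j D j `<=` C.

Definition baire_property B :=
  exists2 U, cyl_open U & comeager [set s | B s <-> U s].

Lemma agree_trans n s t r : agree n s t -> agree n t r -> agree n s r.
Proof. by move=> st tu i ni; rewrite st // tu. Qed.

Lemma agree_le m n s t : (m <= n)%N -> agree n s t -> agree m s t.
Proof. by move=> mn st i im; apply: st; exact: leq_trans mn. Qed.

Lemma comeagerS C C' : C `<=` C' -> comeager C -> comeager C'.
Proof. by move=> CC' [D [oD DC]]; exists D; split=> // s /DC /CC'. Qed.

Lemma comeager_bigcap (C : nat -> set (nat -> A)) :
  (forall k, comeager (C k)) -> comeager (\bigcap_k C k).
Proof.
move=> /choice[D hD].
exists (fun m => if unpickle m is Some (k, j) then D k j else setT); split.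
  move=> m; case: unpickle => [[k j]|]; first exact: (hD k).1.
  by split=> [s _|s n]; [exists 0%N | exists s].
move=> s sD k _; apply: (hD k).2 => j _.
by have := sD (pickle (k, j)) I; rewrite pickleK.
Qed.

Lemma comeagerI C C' : comeager C -> comeager C' -> comeager (C `&` C').
Proof.
move=> hC hC'.
apply: comeagerS (comeager_bigcap (C := fun k => if k is 0%N then C else C') _);
  last by case.
by move=> s sC; split; [exact: (sC 0%N I) | exact: (sC 1%N I)].
Qed.

Lemma comeager_open_dense D : cyl_open D -> cyl_dense D -> comeager D.
Proof. by move=> oD dD; exists (fun=> D); split=> // s /(_ 0%N I). Qed.

(** The generic point is the limit of a sequence of points agreeing on longer
    and longer initial segments, the j-th segment forcing membership in the
    j-th dense open set. *)
Lemma baire C s n : comeager C -> exists2 t, agree n s t & C t.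
Proof.
move=> [D [oD DC]].
have step (j : nat) (p : (nat -> A) * nat) : exists q : (nat -> A) * nat,
    [/\ (p.2 < q.2)%N, agree p.2 p.1 q.1 & agree q.2 q.1 `<=` D j].
  have [t pt Dt] := (oD j).2 p.1 p.2.
  have [m mD] := (oD j).1 _ Dt.
  exists (t, maxn p.2.+1 m); split => //=; first by rewrite leq_maxl.
  by move=> u tu; apply: mD; apply: agree_le tu; rewrite leq_maxr.
have [f hf] := choice (fun jp => step jp.1 jp.2).
pose q := fix q j := if j is j'.+1 then f (j', q j') else (s, n).
have qS j : [/\ ((q j).2 < (q j.+1).2)%N, agree (q j).2 (q j).1 (q j.+1).1
    & agree (q j.+1).2 (q j.+1).1 `<=` D j] by exact: (hf (j, q j)).
have qle i j : (i <= j)%N ->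
    ((q i).2 <= (q j).2)%N /\ agree (q i).2 (q i).1 (q j).1.
  elim: j => [|j IH]; first by rewrite leqn0 => /eqP ->.
  rewrite leq_eqVlt => /predU1P[-> //|]; rewrite ltnS => /IH[le ag].
  have [lt ag' _] := qS j; split; first exact: leq_trans (ltnW lt).
  by apply: agree_trans ag _; exact: agree_le ag'.
have qid j : (j <= (q j).2)%N.
  by elim: j => // j IH; have [lt _ _] := qS j; exact: leq_ltn_trans lt.
(* The (i.+1)-st approximation is final below an index that is at least i.+1,
   hence at i. *)
pose t i := (q i.+1).1 i.
have qt j : agree (q j).2 (q j).1 t.
  move=> i ij; rewrite /t; case: (leqP j i.+1) => [ji|ji].
    by have [_ ->] := qle _ _ ji.
  by have [_ <-] := qle _ _ (ltnW ji) => //; exact: (qid i.+1).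
exists t; first exact: (qt 0%N).
by apply: DC => j _; have [_ _] := qS j; apply; exact: qt.
Qed.

(** A coordinatewise surjection is open and continuous, and preimages of dense
    open sets under such maps are dense open. *)
Lemma comeager_preimage (tau tau' : nat -> A -> A) C :
  (forall i, cancel (tau' i) (tau i)) -> comeager C ->
  comeager [set s | C (fun i => tau i (s i))].
Proof.
move=> tauK [D [oD DC]].
exists (fun j => [set s | D j (fun i => tau i (s i))]); split; last first.
  by move=> s sD; apply: DC => j; exact: sD.
move=> j; split=> [s /(oD j).1[n nD]|s n].
  by exists n => t st; apply: nD => i ni; rewrite st.
have [t st Dt] := (oD j).2 (fun i => tau i (s i)) n.
exists (fun i => if (i < n)%N then s i else tau' i (t i)); first by move=> i ->.
rewrite /=; suff -> : (fun i => tau i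
    (if (i < n)%N then s i else tau' i (t i))) = t by [].
by apply/funext => i; case: ifP => [/st //|_]; rewrite tauK.
Qed.

Lemma cyl_open_baire_property U : cyl_open U -> baire_property U.
Proof.
move=> oU; exists U => //.
  apply: comeagerS (comeager_open_dense (D := setT) _ _) => //.
  by move=> s _; exists 0%N.
by move=> s n; exists s.
Qed.

(** The complement of an open set differs from its interior by a set that is
    closed and has no interior. *)
Lemma baire_property_setC B : baire_property B -> baire_property (~` B).
Proof.
move=> [U oU cU]; pose U' := [set s | exists n, agree n s `<=` ~` U].
have oU' : cyl_open U'.
  move=> s [n nU]; exists n => t st; exists n => u tu.
  exact/nU/(agree_trans st).
exists U' => //.
have cD : comeager (U `|` U').
  apply: comeager_open_dense => [s [/oU[n nU]|/oU'[n nU]]|s n].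
  - by exists n => t /nU; left.
  - by exists n => t /nU; right.
  - case: (pselect (exists2 t, agree n s t & U t)) => [[t st Ut]|h].
      by exists t => //; left.
    by exists s => //; right; exists n => t st Ut; apply: h; exists t.
apply: comeagerS (comeagerI cU cD) => s [/= BU UU']; rewrite BU; split.
  by case: UU'.
by move=> [n nU]; exact: nU.
Qed.

Lemma baire_property_bigcup (B : nat -> set (nat -> A)) :
  (forall k, baire_property (B k)) -> baire_property (\bigcup_k B k).
Proof.
move=> hB; have /choice[U hU] : forall k, exists U, cyl_open U /\
  comeager [set s | B k s <-> U s] by move=> k; have [U] := hB k; exists U.
exists (\bigcup_k U k).
  move=> s [k _ /(hU k).1[n nU]]; exists n => t /nU; exists k => //.
apply: comeagerS (comeager_bigcap (fun k => (hU k).2)) => s sU.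
by split=> -[k _ /(sU k I)]; exists k.
Qed.

Lemma baire_property_sigma_algebra : sigma_algebra setT baire_property.
Proof.
split=> [|B|]; last exact: baire_property_bigcup.
  by apply: cyl_open_baire_property.
by rewrite setTD; exact: baire_property_setC.
Qed.

(** Localized category theorem: a countable cover by sets with the Baire
    property has a member that is generically the whole of some cylinder, and
    this cylinder may be taken inside a given one. A generic point lies in some
    member, hence in the open set that approximates this member. *)
Lemma baire_property_cover (J : countType) (B : J -> set (nat -> A)) s n :
  (forall i, baire_property (B i)) -> (forall t, exists i, B i t) ->
  exists i, exists s' n', [/\ (n <= n')%N, agree n s s' &
    exists2 C, comeager C & agree n' s' `&` C `<=` B i].
Proof.
move=> hB cB; have /choice[U hU] : forall i, exists U, cyl_open U /\
  comeager [set s | B i s <-> U s] by move=> i; have [U] := hB i; exists U.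
have cU : comeager
    (\bigcap_k [set t | forall i, unpickle k = Some i -> (B i t <-> U i t)]).
  apply: comeager_bigcap => k; case: unpickle => [i|].
    by apply: comeagerS (hU i).2 => t Bt _ [<-].
  by apply: comeagerS (comeager_open_dense (D := setT) _ _) => //;
     [move=> ? _; exists 0%N | move=> u ?; exists u].
have [s' ss' s'U] := baire s n cU.
have [i Bi] := cB s'; exists i, s'.
have [m mU] := (hU i).1 _ ((s'U (pickle i) Logic.I _ (pickleK _)).1 Bi).
exists (maxn n m); split; [by rewrite leq_maxl | by [] |].
exists [set s | B i s <-> U i s]; first exact: (hU i).2.
move=> t [st [_ UB]]; apply: UB; apply: mU.
by apply: agree_le st; rewrite leq_maxr.
Qed.

End Category.

(** * Summable sequences and null sequences of bounded variation *)

Section Sequences.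
Variable R : realType.
Implicit Types (a b : nat -> R) (k m n : nat).

Lemma ell1P a :
  ell1 a <-> exists k, forall m, \sum_(i < m) `|a i| <= k%:R.
Proof.
rewrite /ell1 /=; split=> [aoo|[k hk]].
  have fin : (\sum_(0 <= n <oo) `|a n|%:E)%E \is a fin_num.
    rewrite ge0_fin_numE //; apply: nneseries_ge0 => n _ _.
    by rewrite lee_fin.
  exists (Num.bound (fine (\sum_(0 <= n <oo) `|a n|%:E)%E)) => m.
  apply/ltW/(le_lt_trans _ (archi_boundP _)); last first.
    by rewrite fine_ge0 //; apply: nneseries_ge0 => n _ _; rewrite lee_fin.
  rewrite -lee_fin fineK // -sumEFin -(big_mkord xpredT (fun i => `|a i|%:E)).
  by apply: nneseries_lim_ge => n _ _; rewrite lee_fin.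
apply: (@le_lt_trans _ _ k%:R%:E); last by rewrite ltry.
apply: lime_le; first by apply: is_cvg_nneseries => n _ _; rewrite lee_fin.
by apply: nearW => m; rewrite sumEFin lee_fin big_mkord; exact: hk.
Qed.

Lemma bvP a : bv a <-> ell1 (fun n => a n - a n.+1).
Proof. by []. Qed.

Lemma c0P a :
  c0 a <-> forall e : R, 0 < e -> exists N, forall n, (N <= n)%N -> `|a n| < e.
Proof.
rewrite /c0 /=; split=> [/cvgrPdist_lt a0 e e0|h].
  have [N _ hN] := a0 e e0; exists N => n /hN /=.
  by rewrite sub0r normrN.
apply/cvgrPdist_lt => e e0; have [N hN] := h e e0.
by exists N => // n /= /hN; rewrite sub0r normrN.
Qed.

Lemma ell1_c0 a : ell1 a -> c0 a.
Proof.
move=> /ell1P[k hk]; rewrite /c0 /=; apply/norm_cvg0P.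
apply: (cvg_series_cvg_0 (u_ := fun n => `|a n|)).
apply: nondecreasing_is_cvgn.
  by apply: nondecreasing_series.
exists k%:R => _ [m _ <-]; rewrite /series /= big_mkord; exact: hk.
Qed.

(** The variation of a monotone null sequence telescopes. *)
Lemma nonincreasing_bv0 a : (forall n, a n.+1 <= a n) -> (forall n, 0 <= a n) ->
  c0 a -> bv0 a.
Proof.
move=> da a0 ca; split=> //; apply/bvP/ell1P.
exists (Num.bound (a 0%N)) => m.
suff -> : \sum_(i < m) `|a i - a i.+1| = a 0%N - a m.
  by rewrite (le_trans _ (ltW (archi_boundP (a0 0%N)))) // gerBl.
elim: m => [|m IH]; first by rewrite big_ord0 subrr.
rewrite big_ord_recr /= IH ger0_norm ?subr_ge0 //; ring.
Qed.

Definition interleave0 a : nat -> R := fun n => if odd n then 0 else a n./2.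

(** Each term a(i) is met by two consecutive jumps, one up and one down, so the
    variation of the interleaved sequence is about twice the l1 norm of [a]. *)
Lemma interleave0_bv0 a : bv0 (interleave0 a) <-> ell1 a.
Proof.
pose d n := `|interleave0 a n - interleave0 a n.+1|.
have d_even i : d i.*2 = `|a i|.
  by rewrite /d /interleave0 /= odd_double /= doubleK subr0.
have d_odd i : d i.*2.+1 = `|a i.+1|.
  by rewrite /d /interleave0 /= odd_double /= doubleK sub0r normrN.
have sumd m :
    \sum_(i < m.*2) d i = \sum_(i < m) `|a i| + \sum_(i < m) `|a i.+1|.
  elim: m => [|m IH]; first by rewrite !big_ord0 addr0.
  rewrite doubleS !big_ord_recr /= IH d_even d_odd; ring.
split=> [[/bvP/ell1P[k hk] _]|la].
  apply/ell1P; exists k => m; apply: le_trans (hk m.*2).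
  by rewrite [leRHS]sumd lerDl sumr_ge0.
split.
  move/ell1P: la => [k hk]; apply/bvP/ell1P; exists (k + k)%N => m.
  apply: (@le_trans _ _ (\sum_(i < m.*2) d i)).
    rewrite -addnn big_split_ord /= lerDl.
    by apply: sumr_ge0 => i _; exact: normr_ge0.
  rewrite sumd natrD lerD //; apply: le_trans (hk m.+1).
  by rewrite big_ord_recl lerDr.
apply/c0P => e e0; have [N hN] := (c0P a).1 (ell1_c0 la) e e0.
exists N.*2 => n Nn; rewrite /interleave0; case: odd; first by rewrite normr0.
by apply: hN; rewrite -(doubleK N) half_leq.
Qed.

Lemma interleave0B a b :
  (fun n => interleave0 a n - interleave0 b n) =
  interleave0 (fun n => a n - b n).
Proof.
by apply/funext => n; rewrite /interleave0; case: odd; rewrite // subr0.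
Qed.

End Sequences.

(** * Borel functions between sequence spaces *)

Section Borel.
Variable R : realType.

Lemma proj_RN_continuous n : continuous (fun a : RN R => a n : R).
Proof. exact: (@proj_continuous nat (fun=> R) n). Qed.

Lemma RN_continuousP (T : topologicalType) (f : T -> RN R) :
  (forall n, continuous (fun x => f x n : R)) -> continuous f.
Proof.
move=> cf x; apply/(@pointwise_cvgP nat R (f @ x) (f x)) => n.
exact: (cf n x).
Qed.

(** If not, for each n some sequence outside [U] agrees with [a] up to n, and
    these sequences would converge pointwise to [a]. *)
Lemma RN_open_agree (U : set (RN R)) (a : RN R) : open U -> U a ->
  exists n, forall b : RN R, agree n a b -> U b.
Proof.
move=> oU Ua; apply: contrapT => /forallNP h.
have {h} /choice[b hb] : forall n, exists b : RN R, agree n a b /\ ~ U b.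
  by move=> n; move/existsNP: (h n) => [b /not_implyP]; exists b.
have : b n @[n --> \oo] --> a.
  apply/(@pointwise_cvgP nat R (b @ \oo) a) => j.
  apply: cvg_near_cst; exists j.+1 => // n /= jn.
  by have [ag _] := hb n; rewrite (ag j).
move=> /(_ U); rewrite nbhsE =>
  /(_ (ex_intro2 _ _ U (conj oU Ua) (fun _ x => x))).
by move=> [N _ /(_ N (leqnn N))]; exact: (hb N).2.
Qed.

Lemma continuous_borel (Z W : ptopologicalType) (f : Z -> W) :
  continuous f -> borel_fun f.
Proof.
move=> /continuousP cf.
apply: (@measurability _ _ (borel_type Z) (borel_type W) setT f (@open W) erefl).
move=> _ [U oU <-]; rewrite setTI; apply: sub_sigma_algebra; exact: cf.
Qed.

Lemma borel_coord (Z : ptopologicalType) (f : Z -> RN R) n :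
  borel_fun f ->
  measurable_fun [set: borel_type Z] (fun z : borel_type Z => f z n : R).
Proof.
move=> bf; apply: (measurability _ (RGenOpens.measurableE R)).
move=> _ [_ [x [y ->] <-]].
rewrite -[X in _ `&` X]/(f @^-1` ((fun a : RN R => a n : R) @^-1` `]x, y[%classic)).
apply: bf; first exact: measurableT.
apply: sub_sigma_algebra; apply: open_comp.
  by move=> a _; exact: proj_RN_continuous.
exact: interval_open.
Qed.

Lemma ell1_reducible_bv0 :
  borel_reducible (coset_equiv (@ell1 R)) (coset_equiv (@bv0 R)).
Proof.
exists (@interleave0 R : RN R -> RN R).
  apply: continuous_borel; apply: RN_continuousP => n.
  rewrite /interleave0; case: odd; first exact: cst_continuous.
  exact: proj_RN_continuous.
move=> a b; rewrite /coset_equiv interleave0B.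
exact: iff_sym (interleave0_bv0 _).
Qed.

End Borel.

(** * Separating two sequences whose difference is not summable *)

Section Separation.
Variable R : realType.
Implicit Types (a b : nat -> R) (e : seq bool).

Definition signed_sum e a : R :=
  \sum_(i < size e) (-1) ^+ nth false e i * a i.

Lemma signed_sumB_le e a b :
  `|signed_sum e a - signed_sum e b| <= \sum_(i < size e) `|a i - b i|.
Proof.
rewrite -sumrB; apply: le_trans (ler_norm_sum _ _ _) _.
by apply: ler_sum => i _; rewrite -mulrBr normrM normr_sign mul1r.
Qed.

(** The l1 norm is a supremum of finite sums with signs, so an infinite distance
    is witnessed by a sum with signs and a rational threshold: countably many
    possible witnesses, each defined by half-space conditions on [a] and [b]
    separately. *)
Lemma not_ell1_separated a b k : ~ ell1 (fun i => a i - b i) ->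
  exists e (q : rat), ratr q + k%:R < signed_sum e a /\ signed_sum e b < ratr q.
Proof.
move=> nl; have [m hm] : exists m, k%:R < \sum_(i < m) `|a i - b i|.
  apply: contrapT => /forallNP h; apply: nl; apply/ell1P; exists k => m.
  by rewrite leNgt; apply/negP/h.
pose e := mkseq (fun i => a i < b i) m.
have eab : signed_sum e a - signed_sum e b = \sum_(i < m) `|a i - b i|.
  rewrite -sumrB size_mkseq; apply: eq_bigr => i _.
  rewrite -mulrBr nth_mkseq //; case: ltP => ab.
    by rewrite ltr0_norm ?subr_lt0 // expr1 mulN1r.
  by rewrite ger0_norm ?subr_ge0 // expr0 mul1r.
have /rat_in_itvoo[q] : signed_sum e b < signed_sum e a - k%:R by lra.
rewrite in_itv /= => /andP[bq qa]; exists e, q; split=> //; lra.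
Qed.

End Separation.

(** * Coding elements of bv0 by sequences of integers *)

Section Staircase.
Variable R : realType.
Implicit Types (l : nat -> nat) (i j n m : nat).

(** Descends from 2 to 0, the step of height 2^-i being taken at time l(i), or
    at time i when l(i) < i. Delaying a single step from N to m adds
    2^-N 1_[N, m) to the sequence, independently of the other steps, and the
    value at j involves only l(0), ..., l(j). *)
Definition staircase l j : R :=
  2 - \sum_(i < j.+1) (l i <= j)%:R * 2^-1 ^+ i.

Lemma sum_half n : \sum_(i < n) 2^-1 ^+ i = 2 - 2 * 2^-1 ^+ n :> R.
Proof.
elim: n => [|n IH]; first by rewrite big_ord0 expr0 mulr1 subrr.
rewrite big_ord_recr /= IH exprS; lra.
Qed.

Lemma half_ge0 n : 0 <= 2^-1 ^+ n :> R.
Proof. by rewrite exprn_ge0 // invr_ge0. Qed.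

Lemma staircase_ge0 l n : 0 <= staircase l n.
Proof.
rewrite subr_ge0; apply: (@le_trans _ _ (\sum_(i < n.+1) 2^-1 ^+ i)).
  apply: ler_sum => i _; rewrite -[leRHS]mul1r ler_wpM2r ?half_ge0 //.
  by rewrite lern1 leq_b1.
by rewrite sum_half gerBl mulr_ge0 // half_ge0.
Qed.

Lemma staircase_bv0 l : bv0 (staircase l).
Proof.
apply: nonincreasing_bv0 => [n||]; last 2 first.
- exact: staircase_ge0.
- apply/c0P => e e0.
  have [K hK] : exists K, 2 * 2^-1 ^+ K < e :> R.
    have : c0 (fun n => 2^-1 ^+ n : R).
      by apply: cvg_expr; rewrite ger0_norm ?invr_ge0 // invf_lt1 // ltr1n.
    move=> /c0P/(_ (e / 2))[|K /(_ K (leqnn K))]; first by rewrite divr_gt0.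
    rewrite ger0_norm ?half_ge0 // ltr_pdivlMr //; exists K; lra.
  (* From this index on, the first K steps, of total height 2 - 2 * 2^-K, have
     been taken. *)
exists (K + \max_(i < K) l i)%N => n Kn.
  rewrite ger0_norm ?staircase_ge0 //; apply: le_lt_trans hK.
  rewrite lerBlDr -lerBlDl.
  have -> : n.+1 = (K + (n.+1 - K))%N by lia.
  rewrite big_split_ord /= -sum_half -[leLHS]addr0; apply: lerD.
    apply: ler_sum => i _; have -> : (l i <= n)%N.
      apply: leq_trans (leq_trans (leq_addl K _) Kn).
      exact: (leq_bigmax (F := fun i : 'I_K => l i) i).
    by rewrite mul1r.
  by apply: sumr_ge0 => i _; rewrite mulr_ge0 // half_ge0.
- rewrite lerD2l lerN2 [leRHS]big_ord_recr /= -[leLHS]addr0; apply: lerD.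
    apply: ler_sum => i _; apply: ler_wpM2r; first exact: half_ge0.
    by rewrite ler_nat; case: (leqP (l i) n) => [/leqW ->|_]; rewrite ?leq0n.
  by rewrite mulr_ge0 // half_ge0.
Qed.

(** A transposition rather than a constant map to m, because the preimage of a
    comeager set is comeager when each coordinate is mapped surjectively, but
    may be empty when a coordinate is sent to a constant. *)
Definition swap0 m n := if n == 0%N then m else if n == m then 0%N else n.

Lemma swap0K m : involutive (swap0 m).
Proof.
move=> n; rewrite /swap0; case: (eqVneq n 0%N) => [->|n0].
  by rewrite eqxx; case: eqP.
case: (eqVneq n m) => [nm|/negbTE nm]; first by rewrite eqxx.
by rewrite (negbTE n0) nm.
Qed.

Definition swap_at N m : nat -> nat -> nat :=
  fun i => if i == N then swap0 m else id.

Lemma staircase_swap l N m j : l N = 0%N -> (N < m)%N ->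
  staircase (fun i => swap_at N m i (l i)) j =
  staircase l j + (N <= j < m)%:R * 2^-1 ^+ N.
Proof.
move=> lN Nm; rewrite /staircase; set w := fun i => 2^-1 ^+ i : R.
suff -> : \sum_(i < j.+1) (l i <= j)%:R * w i =
    \sum_(i < j.+1) (swap_at N m i (l i) <= j)%:R * w i + (N <= j < m)%:R * w N.
  by rewrite /w; lra.
case: (leqP N j) => Nj /=; last first.
  rewrite mul0r addr0; apply: eq_bigr => i _; rewrite /swap_at.
  by rewrite (_ : (i == N :> nat) = false) //; apply/eqP; have := ltn_ord i; lia.
pose N' : 'I_j.+1 := Ordinal (Nj : (N < j.+1)%N).
rewrite (bigD1 N') // [in RHS](bigD1 N') //= lN /swap_at eqxx /swap0 eqxx leq0n.
rewrite addrAC -mulrDl; congr (_ * _ + _).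
  by rewrite leqNgt; case: (j < m)%N; rewrite /= ?add0r ?addr0.
by apply: eq_bigr => i /negPf iN; rewrite (_ : (i == N :> nat) = false).
Qed.

End Staircase.

(** * Borel functions have the Baire property *)

Section BaireMeasurable.
Variable (A : pointedType) (R : realType).

(** Equipping the points with the sigma-algebra of sets with the Baire property
    makes closure properties of measurable functions available for them. *)
Definition baire_type := g_sigma_algebraType (@baire_property A).

Lemma measurable_baire_property (B : set baire_type) :
  measurable B -> baire_property B.
Proof.
rewrite /measurable /= sigma_algebra_id //.
exact: baire_property_sigma_algebra.
Qed.

(** A map whose first n output coordinates depend only on the first n input
    coordinates is continuous, hence preimages of Borel sets under it have the
    Baire property. *)
Lemma causal_borel_measurable
    (f : (nat -> A) -> RN R) (theta : RN R -> RN R) i :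
  (forall n s t, agree n s t -> agree n (f s) (f t)) -> borel_fun theta ->
  measurable_fun [set: baire_type] (fun s : baire_type => theta (f s) i : R).
Proof.
move=> cf btheta.
have mf : measurable_fun [set: baire_type] (f : baire_type -> borel_type (RN R)).
  apply: (@measurability _ _ baire_type (borel_type (RN R)) setT f
    (@open (RN R)) erefl).
  move=> _ [U oU <-]; rewrite setTI; apply: sub_sigma_algebra.
  apply: cyl_open_baire_property => s Us.
  have [n nU] := RN_open_agree oU Us.
  by exists n => t /cf; exact: nU.
exact: (measurableT_comp (borel_coord i btheta) mf).
Qed.

End BaireMeasurable.

(** * The category argument against a reduction of bv0 to l1 *)

Section NotReducible.
Variable R : realType.
Local Notation point := (nat -> R * nat).
Implicit Types (s t : point) (theta : RN R -> RN R).

(** A point codes a sequence [base s] and an element of bv0, the staircase of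
    its integer coordinates; [shifted s] is their sum. *)
Definition base s : RN R := fun i => (s i).1.

Definition shifted s : RN R :=
  fun i => (s i).1 + staircase R (fun i => (s i).2) i.

Definition jump N : RN R := fun i => (N <= i)%:R * 2^-1 ^+ N.

Lemma agree_base n s t : agree n s t -> agree n (base s) (base t).
Proof. by move=> st i /st; rewrite /base => ->. Qed.

Lemma agree_shifted n s t : agree n s t -> agree n (shifted s) (shifted t).
Proof.
move=> st i ni; rewrite /shifted st //; congr (_ + (_ - _)).
apply: eq_bigr => j _; rewrite st //.
by apply: leq_trans ni; exact: ltn_ord.
Qed.

Lemma jump_not_bv0 N : ~ bv0 (jump N).
Proof.
move=> [_ /c0P/(_ (2^-1 ^+ N))[|M hM]].
  by rewrite exprn_gt0 // invr_gt0.
have := hM (maxn M N) (leq_maxl _ _).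
by rewrite /jump leq_maxr mul1r ger0_norm ?half_ge0 // ltxx.
Qed.

Lemma shift_equiv s : coset_equiv (@bv0 R) (shifted s) (base s).
Proof.
rewrite /coset_equiv (_ : (fun n => _) = staircase R (fun i => (s i).2)).
  exact: staircase_bv0.
by apply/funext => i; rewrite /shifted /base addrC addKr.
Qed.

Lemma jump_not_equiv N (a : RN R) :
  ~ coset_equiv (@bv0 R) (fun i => a i + jump N i) a.
Proof.
rewrite /coset_equiv (_ : (fun n => _) = jump N); first exact: jump_not_bv0.
by apply/funext => i; rewrite addrC addKr.
Qed.

Definition swap_step N m s : point :=
  fun i => ((s i).1, swap_at N m i (s i).2).

Definition cut_base N m s : point :=
  fun i => ((s i).1 - (m <= i)%:R * 2^-1 ^+ N, (s i).2).

Lemma comeager_swap_step N m C :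
  comeager C -> comeager [set s | C (swap_step N m s)].
Proof.
pose tau i (p : R * nat) := (p.1, swap_at N m i p.2).
apply: (comeager_preimage (tau := tau) (tau' := tau)).
by move=> i [x k]; rewrite /tau /swap_at /=; case: eqP; rewrite ?swap0K.
Qed.

Lemma comeager_cut_base N m C :
  comeager C -> comeager [set s | C (cut_base N m s)].
Proof.
apply: (comeager_preimage
  (tau := fun i (p : R * nat) => (p.1 - (m <= i)%:R * 2^-1 ^+ N, p.2))
  (tau' := fun i (p : R * nat) => (p.1 + (m <= i)%:R * 2^-1 ^+ N, p.2))).
by move=> i [x k]; rewrite /= addrK.
Qed.

(** On [N, m) both sides exceed [shifted s] by 2^-N; from m on, the cut cancels
    the jump. The left-hand point agrees with [s] up to m, the right-hand one
    has the same base as [s]. *)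
Lemma shifted_cut_jump N m s : (s N).2 = 0%N -> (N < m)%N ->
  (fun i => shifted (cut_base N m s) i + jump N i) = shifted (swap_step N m s).
Proof.
move=> sN Nm; apply/funext => i.
rewrite /shifted /cut_base /swap_step /jump /= staircase_swap //.
case: (leqP m i) => mi.
  by rewrite (leq_trans (ltnW Nm) mi) /=; lra.
by rewrite andbT mul0r subr0 -addrA.
Qed.

(** The sets { |theta(shifted t) - theta(base t)|_1 <= k }, for k in N, cover
    the space since [shifted t] and [base t] are bv0-equivalent; one of them is
    generically a whole cylinder. *)
Lemma borel_uniform_bound theta : borel_fun theta ->
  (forall x y, coset_equiv (@bv0 R) x y <->
               coset_equiv (@ell1 R) (theta x) (theta y)) ->
  exists k N s, exists2 C, comeager C & forall t, agree N s t -> C t ->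
    forall m, \sum_(i < m) `|theta (shifted t) i - theta (base t) i| <= k%:R.
Proof.
move=> btheta red.
pose B (k : nat) : set point :=
  [set t | forall m,
    \sum_(i < m) `|theta (shifted t) i - theta (base t) i| <= k%:R].
have mtheta i (f : point -> RN R) :
    (forall n s t, agree n s t -> agree n (f s) (f t)) ->
    measurable_fun [set: baire_type (R * nat)%type]
      (fun s : baire_type (R * nat)%type => theta (f s) i : R).
  by move=> cf; exact: causal_borel_measurable.
have [|t|k [s [N [_ _ [C cC NC]]]]] :=
    @baire_property_cover _ nat B (fun=> (0, 0%N)) 0%N.
- move=> k; apply: measurable_baire_property.
  rewrite (_ : B k = \bigcap_m [set t : baire_type (R * nat)%type |
    \sum_(i < m) `|theta (shifted t) i - theta (base t) i| <= k%:R]); last first.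
    by apply/seteqP; split=> t tB m; [move=> _; exact: tB | exact: tB].
  apply: bigcapT_measurable => m; rewrite -[X in measurable X]setTI.
  have : measurable_fun [set: baire_type (R * nat)%type]
    (fun t : baire_type (R * nat)%type =>
      \sum_(i < m) `|theta (shifted t) i - theta (base t) i| : R).
    apply: measurable_sum => i; apply: measurableT_comp => //.
    by apply: measurable_funB; apply: mtheta;
      [exact: agree_shifted | exact: agree_base].
  move=> /(_ measurableT `]-oo, k%:R]%classic (measurable_itv _)).
  by congr measurable; apply/seteqP; split=> t /=; rewrite in_itv.
- by have /ell1P[k hk] := (red _ _).1 (shift_equiv t); exists k.
- by exists k, N, s, C => // t st Ct; exact: NC.
Qed.

(** Every point admits a separating sum with signs and a rational threshold, and
    there are countably many of these; one of them serves generically on a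
    whole cylinder. Extending a prescribed initial segment of length N.+1 makes
    it possible to fix the N-th coordinate beforehand. *)
Lemma borel_separation theta N k s : borel_fun theta ->
  (forall x y, coset_equiv (@bv0 R) x y <->
               coset_equiv (@ell1 R) (theta x) (theta y)) ->
  exists e (q : rat) m t, [/\ (N < m)%N, agree N.+1 s t &
    exists2 C, comeager C & forall u, agree m t u -> C u ->
    signed_sum e (theta (shifted u)) < ratr q /\
    ratr q + k%:R <
      signed_sum e (theta (fun i => shifted u i + jump N i))].
Proof.
move=> btheta red.
pose B (p : seq bool * rat) : set point :=
  [set u | signed_sum p.1 (theta (shifted u)) < ratr p.2 /\
    ratr p.2 + k%:R <
      signed_sum p.1 (theta (fun i => shifted u i + jump N i))].
have msum e (f : point -> RN R) :
    (forall n s t, agree n s t -> agree n (f s) (f t)) ->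
    measurable_fun [set: baire_type (R * nat)%type]
      (fun s : baire_type (R * nat)%type => signed_sum e (theta (f s)) : R).
  move=> cf; apply: measurable_sum => i; apply: measurable_funM => //.
  exact: causal_borel_measurable.
have [|u|[e q] [t [m [Nm st [C cC mC]]]]] := @baire_property_cover _ _ B s N.+1.
- move=> [e q]; apply: measurable_baire_property; apply: measurableI.
    rewrite -[X in measurable X]setTI.
    have := msum e _ agree_shifted measurableT
      `]-oo, ratr q[%classic (measurable_itv _).
    by congr measurable; apply/seteqP; split=> t /=; rewrite in_itv.
  rewrite -[X in measurable X]setTI.
  have cj n u t : agree n u t -> agree n (fun i => shifted u i + jump N i)
      (fun i => shifted t i + jump N i).
    by move=> /agree_shifted ut i ni; rewrite ut.
  have := msum e _ cj measurableT
    `]ratr q + k%:R, +oo[%classic (measurable_itv _).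
  by congr measurable; apply/seteqP; split=> t /=; rewrite in_itv /= andbT.
- have : ~ ell1 (fun i => theta (fun i => shifted u i + jump N i) i -
      theta (shifted u) i) by move/(red _ _).2; exact: jump_not_equiv.
  by move=> /(not_ell1_separated k)[e [q [h1 h2]]]; exists (e, q).
- by exists e, q, m, t; split=> //; exists C => // u tu Cu; exact: mC.
Qed.

Lemma bv0_not_reducible_ell1 :
  ~ borel_reducible (coset_equiv (@bv0 R)) (coset_equiv (@ell1 R)).
Proof.
move=> [theta btheta red].
have [k [N [s [C cC sC]]]] := borel_uniform_bound btheta red.
(* With l(N) = 0 the N-th step of the staircase is taken as early as possible,
   so that swapping 0 with m in coordinate N delays it until m. *)
pose s0 : point := fun i => if i == N then (0, 0%N) else s i.
have [e [q [m [t [Nm st [C' cC' tC']]]]]] :=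
  borel_separation N (k + k) s0 btheta red.
(* A single u such that u and its swapped version are generic for the bound, and
   u and its cut version are generic for the separation. *)
have [u tu [[Cu Cu'] [Cu1 Cu2]]] := baire t m (comeagerI
  (comeagerI cC (comeager_swap_step N m cC))
  (comeagerI cC' (comeager_cut_base N m cC'))).
have s0u : agree N.+1 s0 u by apply: agree_trans st _; exact: agree_le tu.
have uN : (u N).2 = 0%N by rewrite -s0u // /s0 eqxx.
have su : agree N s u.
  move=> i iN; rewrite -s0u /s0 ?ltn_eqF //; exact: leqW.
have su' : agree N s (swap_step N m u).
  by move=> i iN; rewrite su // /swap_step /swap_at ltn_eqF //; case: (u i).
have tu' : agree m t (cut_base N m u).
  move=> i im; rewrite tu // /cut_base leqNgt im mul0r subr0.
  by case: (u i).
have [sepl _] := tC' u tu Cu1.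
have [_ sepr] := tC' _ tu' Cu2; rewrite shifted_cut_jump // in sepr.
have := le_trans (signed_sumB_le e _ _) (sC u su Cu (size e)).
have := le_trans (signed_sumB_le e _ _) (sC _ su' Cu' (size e)).
have -> : base (swap_step N m u) = base u by [].
move: sepl sepr; rewrite natrD !ler_norml => sepl sepr /andP[_ h1] /andP[h2 _].
move: (k%:R : R) (ratr q : R) h1 h2 sepl sepr => K Q.
move: (signed_sum e _) (signed_sum e _) (signed_sum e _) => x y z.
by clear; lra.
Qed.

End NotReducible.

Theorem theorem5p10 (R : realType) :
  borel_strictly_reducible (coset_equiv (@ell1 R)) (coset_equiv (@bv0 R)).
Proof.
by split; [exact: ell1_reducible_bv0 | exact: bv0_not_reducible_ell1].
Qed.
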